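(* $\mathfrak{S}_{00}(\Sigma,\mathcal{A})$ is dense in $\mathfrak{S}_{0}(\Sigma,\mathcal{A})$ with respect to the norm $\|\cdot\|_\infty$.
   Context: Setting. $G$ is a locally compact group, $K$ a compact subgroup of $G$, $\lambda$ and $\nu$ are left Haar measures on $G$ and $K$ ($\nu$ of total mass $1$), and $\mu$ is a $G$-invariant Radon measure on $G/K$ such that $\int_G f\,d\lambda=\int_{G/K}d\mu(\dot g)\int_K f(gk)\,d\nu(k)$ for all compactly supported continuous $f$. $\mathcal{A}$ is a complex Banach space. $\Sigma$ is the dual object of $K$ (equivalence classes of irreducible unitary representations); for $\sigma\in\Sigma$, $L^\sigma$ is a representative acting on $H_\sigma$, with $d_\sigma=\dim H_\sigma<\infty$. Induced representation. $H^{L^\sigma}$ is the Hilbert space completion of the space of continuous $u:G\to H_\sigma$ with $u(gk)=L^\sigma_{k^{-1}}u(g)$ ($g\in G$, $k\in K$) whose support has compact image in $G/K$, for the inner product $\langle u,v\rangle=\int_{G/K}\langle u(g),v(g)\rangle_{H_\sigma}d\mu(\dot g)$. $U^{L^\sigma}$ is the unitary representation of $G$ on $H^{L^\sigma}$ with $U^{L^\sigma}_tu(g)=u(t^{-1}g)$. It is assumed that $K$ is such that $L^\sigma$ and $U^{L^\sigma}$ are both irreducible, and $H^{L^\sigma}$ is separable. Spaces. $\mathfrak{S}(\Sigma,\mathcal{A})=\prod_{\sigma\in\Sigma}\mathcal{S}(H^{L^\sigma}\times H^{L^\sigma},\mathcal{A})$, where $\mathcal{S}(H^{L^\sigma}\times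 H^{L^\sigma},\mathcal{A})$ is the set of all sesquilinear mappings $H^{L^\sigma}\times H^{L^\sigma}\to\mathcal{A}$. For $\Phi\in\mathfrak{S}(\Sigma,\mathcal{A})$, $\|\Phi(\sigma)\|=\sup\{\|\Phi(\sigma)(u,v)\|_{\mathcal{A}}:\|u\|\le1,\|v\|\le1\}$ and $\|\Phi\|_\infty=\sup_{\sigma\in\Sigma}\|\Phi(\sigma)\|$. Then: - $\mathfrak{S}_{00}(\Sigma,\mathcal{A})=\{\Phi:\{\sigma:\Phi(\sigma)\ne0\}\text{ is finite}\}$; - $\mathfrak{S}_0(\Sigma,\mathcal{A})=\{\Phi:\forall\varepsilon>0,\ \{\sigma:\|\Phi(\sigma)\|>\varepsilon\}\text{ is finite}\}$. *)

(* Defs.v *)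
From HB Require Import structures.
From mathcomp Require Import all_boot all_order all_algebra complex.
From mathcomp Require Import all_classical all_reals all_analysis.
From mathcomp Require Import sesquilinear.

Set Implicit Arguments.
Unset Strict Implicit.
Unset Printing Implicit Defensive.

Import Order.TTheory GRing.Theory Num.Theory.
Import numFieldNormedType.Exports.

Local Open Scope classical_set_scope.
Local Open Scope ring_scope.
Local Open Scope complex_scope.
Local Open Scope quotient_scope.

HB.mixin Record isTopologicalGroup G of Topological G & Group G := {
  mulg_continuous : continuous (fun p : G * G => (p.1 * p.2)%g) ;
  invg_continuous : continuous (fun g : G => g^-1%g)
}.

(* The distinguished point plays no role in the mathematics: it is there because
   a measurableType is pointed. *)
#[short(type="topologicalGroupType")]
HB.structure Definition TopologicalGroup :=
  {G of PointedTopological G & Group G & isTopologicalGroup G}.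

Record subgroup (G : topologicalGroupType) := Subgroup {
  subgroup_set :> set G ;
  subgroup_closed : group_closed (mem subgroup_set)
}.

(* A subgroup regarded as a topological group of its own. *)
Definition subgroup_type (G : topologicalGroupType) (K : subgroup G) : Type :=
  set_type K.

Section subgroup_type.
Context {G : topologicalGroupType} (K : subgroup G).

HB.instance Definition _ := SubChoice.copy (subgroup_type K) (set_type K).
HB.instance Definition _ := SubChoice_isSubGroup.Build G
  (fun g => g \in subgroup_set K) (subgroup_type K) (subgroup_closed K).
HB.instance Definition _ := Topological.copy (subgroup_type K) (set_type K).
HB.instance Definition _ := isPointed.Build (subgroup_type K) 1%g.

Let incl (k : subgroup_type K) : G := \val k.

Let incl_continuous : continuous incl.
Proof. exact: initial_continuous. Qed.

Let into_subgroup (T : topologicalType) (f : T -> subgroup_type K) :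
  continuous (incl \o f) -> continuous f.
Proof. by move=> cf; apply/continuous_comp_initial; exact: cf. Qed.

Let mulg_continuous :
  continuous (fun p : subgroup_type K * subgroup_type K => (p.1 * p.2)%g).
Proof.
apply: into_subgroup => p.
have -> : incl \o (fun p => (p.1 * p.2)%g) = (fun p => (incl p.1 * incl p.2)%g).
  by apply/funext => q /=; rewrite /incl valM.
apply: (continuous_comp (f := fun p => (incl p.1, incl p.2))
                        (g := fun p => (p.1 * p.2)%g)).
  apply: cvg_pair => /=.
    by apply: continuous_comp; [exact: cvg_fst|exact: incl_continuous].
  by apply: continuous_comp; [exact: cvg_snd|exact: incl_continuous].
exact: mulg_continuous.
Qed.

Let invg_continuous : continuous (fun k : subgroup_type K => k^-1%g).
Proof.
apply: into_subgroup => k.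
have -> : incl \o (fun k => k^-1%g) = (fun k => (incl k)^-1%g).
  by apply/funext => q /=; rewrite /incl; apply: (gmulfV (\val : subgroup_type K -> G)).
by apply: continuous_comp; [exact: incl_continuous|exact: invg_continuous].
Qed.

HB.instance Definition _ :=
  isTopologicalGroup.Build (subgroup_type K) mulg_continuous invg_continuous.

End subgroup_type.

Section coset_space.
Context {G : topologicalGroupType} (K : subgroup G).

Definition lcoset_rel : rel G := fun g h => (g^-1 * h)%g \in subgroup_set K.

Let lcoset_rel_refl : reflexive lcoset_rel.
Proof. by move=> g; rewrite /lcoset_rel mulVg; case: (subgroup_closed K). Qed.

Let lcoset_rel_sym : symmetric lcoset_rel.
Proof.
suff sym g h : lcoset_rel g h -> lcoset_rel h g by move=> g h; apply/idP/idP; exact: sym.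
rewrite /lcoset_rel => /(group_closedV (subgroup_closed K)).
by rewrite invgM invgK.
Qed.

Let lcoset_rel_trans : transitive lcoset_rel.
Proof.
move=> h g l; rewrite /lcoset_rel => Kgh Khl.
have := group_closedM (subgroup_closed K) Kgh Khl.
by rewrite -mulgA mulVKg.
Qed.

Canonical lcoset_equiv :=
  EquivRel lcoset_rel lcoset_rel_refl lcoset_rel_sym lcoset_rel_trans.

(* G / K, the space of left cosets gK, with the quotient topology. *)
Definition coset_space : ptopologicalType :=
  quotient_topology {eq_quot lcoset_equiv}.

End coset_space.

Definition coset_act (G : topologicalGroupType) (K : subgroup G)
    (t : G) (x : coset_space K) : coset_space K :=
  \pi_(coset_space K) (t * repr x)%g.

Definition borel (T : ptopologicalType) := g_sigma_algebraType (@open T).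

Definition cintegral (R : realType) d (T : measurableType d)
    (m : {measure set T -> \bar R}) (f : T -> R[i]) : R[i] :=
  (\int[m]_x complex.Re (f x)) +i* (\int[m]_x complex.Im (f x)).

Section measures.
Context {R : realType}.

Definition radon_measure (T : ptopologicalType)
    (m : {measure set (borel T) -> \bar R}) : Prop :=
  [/\ forall C : set T, compact C -> (m C < +oo)%E,
      forall B : set (borel T), measurable B ->
        m B = ereal_inf [set m U | U in [set U : set T | open U /\ B `<=` U]] &
      forall U : set T, open U ->
        m U = ereal_sup [set m C | C in [set C : set T | compact C /\ C `<=` U]]].

Definition left_haar_measure (G : topologicalGroupType)
    (m : {measure set (borel G) -> \bar R}) : Prop :=
  [/\ radon_measure m, m [set: G] != 0%E &
      forall (t : G) (B : set (borel G)), measurable B ->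
        m ((fun g : G => (t * g)%g) @^-1` B) = m B].

Definition invariant_measure (G : topologicalGroupType) (K : subgroup G)
    (m : {measure set (borel (coset_space K)) -> \bar R}) : Prop :=
  forall (t : G) (B : set (borel (coset_space K))), measurable B ->
    m (coset_act t @^-1` B) = m B.

(* The integrand on G/K is evaluated at a representative of each coset; the
   inner integral does not depend on it, as nu is left invariant. *)
Definition weil_formula (G : topologicalGroupType) (K : subgroup G)
    (lambda : {measure set (borel G) -> \bar R})
    (nu : {measure set (borel (subgroup_type K)) -> \bar R})
    (mu : {measure set (borel (coset_space K)) -> \bar R}) : Prop :=
  forall f : G -> R[i], continuous (f : G -> R[i]^o) ->
    compact (closure [set g | f g != 0]) ->
    cintegral lambda f =
    cintegral mu (fun x =>
      cintegral nu (fun k => f (repr x * \val (k : subgroup_type K))%g)).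

End measures.

Record hilbertSpace (R : realType) := HilbertSpace {
  hilbert_sort :> completeNormedModType R[i] ;
  hdot : {dot hilbert_sort for Num.conj} ;
  hdot_norm : forall u, `|u| ^+ 2 = hdot u u
}.

Section representations.
Context {R : realType} {G : topologicalGroupType}.

Record unitary_rep := UnitaryRep {
  rep_space : hilbertSpace R ;
  rep_map :> G -> rep_space -> rep_space ;
  rep_linear : forall g, linear (rep_map g) ;
  rep_dot : forall g u v, hdot _ (rep_map g u) (rep_map g v) = hdot _ u v ;
  rep1 : forall u, rep_map 1%g u = u ;
  repM : forall g h u, rep_map (g * h)%g u = rep_map g (rep_map h u) ;
  rep_continuous : forall u, continuous (rep_map^~ u)
}.

Definition irreducible_rep (rho : unitary_rep) : Prop :=
  (exists u : rep_space rho, u != 0) /\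
  forall W : set (rep_space rho),
    closed W -> GRing.submod_closed (mem W) ->
    (forall g u, W u -> W (rho g u)) ->
    W = [set 0] \/ W = setT.

Definition equivalent_rep (rho tau : unitary_rep) : Prop :=
  exists T : rep_space rho -> rep_space tau,
    [/\ linear T, bijective T,
        forall u v, hdot _ (T u) (T v) = hdot _ u v &
        forall g u, T (rho g u) = tau g (T u)].

Record dual_object := DualObject {
  dual_class : unitary_rep -> Prop ;
  dual_classP : exists2 rho, irreducible_rep rho &
    dual_class = equivalent_rep rho
}.

End representations.
Arguments unitary_rep : clear implicits.
Arguments dual_object : clear implicits.

Section induced_representation.
Context {R : realType} {G : topologicalGroupType} {K : subgroup G}.
Variable mu : {measure set (borel (coset_space K)) -> \bar R}.
Variable L : unitary_rep R (subgroup_type K).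

Definition induced_fun : set (G -> rep_space L) :=
  [set u | [/\ continuous u,
    forall g (k : subgroup_type K), u (g * \val k)%g = L k^-1%g (u g) &
    compact (\pi_(coset_space K) @` closure [set g | u g != 0])]].

(* For u, v in induced_fun the integrand is constant on each coset, because L is
   unitary. *)
Definition induced_dot (u v : G -> rep_space L) : R[i] :=
  cintegral mu (fun x => hdot _ (u (repr x)) (v (repr x))).

(* The completion H^L of induced_fun is given by its universal description: a
   Hilbert space with a linear isometric map from induced_fun that has dense
   range. Only the values of induced_incl on induced_fun matter. *)
Record induced_rep := InducedRep {
  induced :> unitary_rep R G ;
  induced_incl : (G -> rep_space L) -> rep_space induced ;
  induced_incl_linear : forall (a : R[i]) u v,
    induced_fun u -> induced_fun v ->
    induced_incl (fun g => a *: u g + v g) =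
    a *: induced_incl u + induced_incl v ;
  induced_incl_dot : forall u v, induced_fun u -> induced_fun v ->
    hdot _ (induced_incl u) (induced_incl v) = induced_dot u v ;
  induced_incl_dense : dense (induced_incl @` induced_fun) ;
  induced_act : forall t u, induced_fun u ->
    induced t (induced_incl u) = induced_incl (fun g => u (t^-1 * g)%g)
}.

End induced_representation.

Definition separable (T : topologicalType) : Prop :=
  exists2 D : set T, countable D & dense D.

(* The dual object is a type of classes of Hilbert space representations, hence
   lies above the universe of the library's [set]. Sets of its elements, and of
   families indexed by it, are therefore plain predicates, and finiteness of such
   a predicate is stated by an enumeration instead of [finite_set]. *)
Definition finitely_many (I : Type) (P : I -> Prop) : Prop :=
  exists (n : nat) (e : 'I_n -> I), forall i, P i -> exists k, e k = i.

Section sesquilinear_families.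
Context {R : realType} {I : Type}.
Variables (H : I -> hilbertSpace R) (A : completeNormedModType R[i]).

Definition sesqui_family : Type :=
  forall i, {bilinear H i -> H i -> A | *:%R & (Num.conj \; *:%R)}.

Definition sesqui_norm i (f : H i -> H i -> A) : \bar R :=
  ereal_sup [set r | exists u v,
    [/\ `|u| <= 1, `|v| <= 1 & r = (complex.Re `|f u v|)%:E]].

Definition sesqui_sup_norm (f : forall i, H i -> H i -> A) : \bar R :=
  ereal_sup [set r | exists i, r = sesqui_norm (f i)].

Definition sesqui_finite_support (Phi : sesqui_family) : Prop :=
  finitely_many (fun i => exists u v, Phi i u v != 0).

Definition sesqui_vanishing (Phi : sesqui_family) : Prop :=
  forall eps : R, 0 < eps ->
    finitely_many (fun i => (eps%:E < sesqui_norm (Phi i))%E).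

(* Phi and Psi may have unbounded components, so that the sup norm of their
   difference lives in \bar R. *)
Definition sup_norm_dense_in (D S : sesqui_family -> Prop) : Prop :=
  (forall Phi, D Phi -> S Phi) /\
  forall Phi, S Phi -> forall eps : R, 0 < eps ->
    exists2 Psi, D Psi &
      (sesqui_sup_norm (fun i u v => (Phi i u v - Psi i u v)%R) < eps%:E)%E.

End sesquilinear_families.
Arguments sesqui_finite_support {R I} H A Phi.
Arguments sesqui_vanishing {R I} H A Phi.

(* Main.v *)
Require Import Defs.
From HB Require Import structures.
From mathcomp Require Import all_boot all_order all_algebra complex.
From mathcomp Require Import all_classical all_reals all_analysis.
From mathcomp Require Import sesquilinear.

Set Implicit Arguments.
Unset Strict Implicit.
Unset Printing Implicit Defensive.

Import Order.TTheory GRing.Theory Num.Theory.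
Import numFieldNormedType.Exports.
Local Open Scope classical_set_scope.
Local Open Scope ring_scope.
Local Open Scope complex_scope.

Section sesquilinear_families.
Context {R : realType} {I : Type}.
Variables (H : I -> hilbertSpace R) (A : completeNormedModType R[i]).

(** The proof is by truncation. Given a vanishing family [Phi] and [eps], keep the components of
    norm greater than [eps / 2] and replace the others by zero. Vanishing leaves finitely many kept
    components, and the error is zero at each of these and of norm at most [eps / 2] elsewhere.
    [sesqui_finite_support_dense] does this for a family of Hilbert spaces over any index type. *)

Definition zero_sesqui i : H i -> H i -> A := fun _ _ => 0.

(** Lets the zero map serve as a component of a [sesqui_family]. *)
Lemma zero_sesqui_bilinear i :
  bilinear_for *:%R (Num.conj \; *:%R) (@zero_sesqui i).
Proof. by split=> u a v w; rewrite /zero_sesqui /= scaler0 addr0. Qed.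

HB.instance Definition _ i := bilinear_isBilinear.Build R[i] (H i) (H i) A
  *:%R (Num.conj \; *:%R) (@zero_sesqui i) (@zero_sesqui_bilinear i).

Lemma sesqui_norm_le i (f : H i -> H i -> A) (c : R) :
  (forall u v, `|u| <= 1 -> `|v| <= 1 -> (complex.Re `|f u v| <= c)%R) ->
  (sesqui_norm f <= c%:E)%E.
Proof.
move=> fc; apply: ge_ereal_sup => _ [u [v [u1 v1 ->]]].
by rewrite lee_fin fc.
Qed.

(** A component of positive norm takes a nonzero value, so one enumeration of the support works for
    every [eps]. *)
Lemma sesqui_finite_support_vanishing (Phi : sesqui_family H A) :
  sesqui_finite_support H A Phi -> sesqui_vanishing H A Phi.
Proof.
move=> [n [e Phi_e]] eps eps0; exists n, e => i lt_eps; apply: Phi_e.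
apply: contrapT => Phi0; move: lt_eps; apply/negP; rewrite -leNgt.
apply: sesqui_norm_le => u v _ _.
have [->|nz] := eqVneq (Phi i u v) 0; first by rewrite normr0 ltW.
by case: Phi0; exists u, v.
Qed.

Lemma sesqui_finite_support_dense :
  sup_norm_dense_in (sesqui_finite_support H A) (sesqui_vanishing H A).
Proof.
split; first exact: sesqui_finite_support_vanishing.
move=> Phi Phi_vanish eps eps0.
(* Bounding a supremum yields only a weak inequality; halving [eps] makes the final one strict. *)
have eps20 : 0 < eps / 2 by rewrite divr_gt0.
(* The comparison is made in [\bar R], so components of infinite norm are kept and cancel exactly in
   the difference. *)
pose Psi : sesqui_family H A := fun i =>
  if ((eps / 2)%:E < sesqui_norm (Phi i))%E then Phi i else @zero_sesqui i.
exists Psi.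
  have [n [e large_e]] := Phi_vanish _ eps20.
  exists n, e => i [u [v]]; rewrite /Psi.
  by case: ifPn => [/large_e //|_]; rewrite eqxx.
apply: (@le_lt_trans _ _ (eps / 2)%:E); last first.
  by rewrite lte_fin ltr_pdivrMr // ltr_pMr // ltr1n.
apply: ge_ereal_sup => _ [i ->]; rewrite /Psi; case: ifPn => [_|].
  by apply: sesqui_norm_le => u v _ _; rewrite subrr normr0 ltW.
(* At a dropped index the difference is [Phi i - 0], whose values are those of [Phi i]. *)
rewrite -leNgt; apply: le_trans; apply: ereal_sup_le => _ [u [v [u1 v1 ->]]].
by exists u, v; rewrite subr0.
Qed.

End sesquilinear_families.

Theorem proposition2p3 (R : realType) (G : topologicalGroupType) (K : subgroup G)
  (G_hausdorff : hausdorff_space G) (G_loc_compact : locally_compact [set: G])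
  (K_compact : compact (subgroup_set K))
  (lambda : {measure set (borel G) -> \bar R})
  (nu : {measure set (borel (subgroup_type K)) -> \bar R})
  (mu : {measure set (borel (coset_space K)) -> \bar R})
  (lambda_haar : left_haar_measure lambda)
  (nu_haar : left_haar_measure nu) (nu1 : nu setT = 1%E)
  (mu_radon : radon_measure mu) (mu_inv : invariant_measure mu)
  (weil : weil_formula lambda nu mu)
  (A : completeNormedModType R[i])
  (L : dual_object R (subgroup_type K) -> unitary_rep R (subgroup_type K))
  (L_repr : forall sigma, dual_class sigma (L sigma))
  (U : forall sigma, induced_rep mu (L sigma))
  (L_irr : forall sigma, irreducible_rep (L sigma))
  (U_irr : forall sigma, irreducible_rep (U sigma))
  (H_separable : forall sigma, separable (rep_space (U sigma))) :
  sup_norm_dense_in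
    (sesqui_finite_support (fun sigma => rep_space (U sigma)) A)
    (sesqui_vanishing (fun sigma => rep_space (U sigma)) A).
Proof.
(* Here the index type is the dual object of [K], and the spaces are those of the induced
   representations. *)
exact: sesqui_finite_support_dense.
Qed.
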